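(* Let $A\in\mathbb{R}^{n\times n}$, let $b\in\mathbb{R}^n$ with $b\in\operatorname{ran}(A)$, and let $\sigma$ be an activation function with $\sigma(x)=0$ for $x\le 0$, the prototypical example being $\sigma(x)=\operatorname{ReLU}(x)=\max(x,0)$ or any smoothed version of it. Let $T:\mathbb{R}^n\to\mathbb{R}^n$ be the single-layer network $T(u)=\sigma(Au+b)$, with $\sigma$ applied component-wise. Then the kernel $\ker(T)=\{u\in\mathbb{R}^n : T(u)=0\}$ is a polyhedral convex cone with tip $u_0$, where $Au_0=-b$. Furthermore, $$\ker(T)=\{u+u_0\in\mathbb{R}^n : -Au\ge 0\}.$$
   Context: A set $C\subset\mathbb{R}^n$ is called a convex cone with tip $v_0\in\mathbb{R}^n$ if $u+\alpha(u-v_0)\in C$ for all $u\in C$ and all $\alpha\ge 0$. It is called polyhedral if it can be written as $C=\{u+v_0\in\mathbb{R}^n : Mu\ge 0\}$ with some matrix $M\in\mathbb{R}^{n\times n}$. Vector inequalities are understood component-wise. $\operatorname{ran}(A)$ denotes the range of $A$.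
   Formalization: The activation function is additionally assumed to satisfy σ(x) ≠ 0 for x > 0 (as ReLU does); without this the claim fails, e.g. for n = 1, A = 1, b = 0, σ = 0, where ker(T) is all of ℝ but the stated set is {u ≤ 0}. *)

(* Defs.v *)
From mathcomp Require Import all_boot all_order all_algebra.
From mathcomp Require Import classical_sets reals.

Set Implicit Arguments.
Unset Strict Implicit.
Unset Printing Implicit Defensive.

Import Order.TTheory GRing.Theory Num.Theory.

Local Open Scope classical_set_scope.
Local Open Scope ring_scope.

Definition cv_ge0 (R : realType) (n : nat) (v : 'cV[R]_n) : Prop :=
  forall i : 'I_n, 0 <= v i 0.

(* The cone convention is the one of the source: C is stable under moving away
   from the tip v0. Convexity of C as a set is not a separate clause. *)
Definition convex_cone (R : realType) (n : nat) (v0 : 'cV[R]_n)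
    (C : set 'cV[R]_n) : Prop :=
  forall (u : 'cV[R]_n) (alpha : R),
    C u -> 0 <= alpha -> C (u + alpha *: (u - v0)).

Definition polyhedral (R : realType) (n : nat) (v0 : 'cV[R]_n)
    (C : set 'cV[R]_n) : Prop :=
  exists M : 'M[R]_n, C = [set u + v0 | u in [set u | cv_ge0 (M *m u)]].

Definition polyhedral_convex_cone (R : realType) (n : nat) (v0 : 'cV[R]_n)
    (C : set 'cV[R]_n) : Prop :=
  convex_cone v0 C /\ polyhedral v0 C.

Definition layer (R : realType) (n : nat) (sigma : R -> R) (A : 'M[R]_n)
    (b u : 'cV[R]_n) : 'cV[R]_n :=
  map_mx sigma (A *m u + b).

(* Zero set of a (generally nonlinear) map. *)
Definition ker (R : realType) (n : nat) (T : 'cV[R]_n -> 'cV[R]_n) :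
    set 'cV[R]_n :=
  [set u | T u = 0].

(* Main.v *)
Require Import Defs.
From mathcomp Require Import all_boot all_order all_algebra.
From mathcomp Require Import classical_sets reals.

Import Order.TTheory GRing.Theory Num.Theory.

Local Open Scope classical_set_scope.
Local Open Scope ring_scope.

(** The activation vanishes exactly on the nonpositive half-line, so the layer
    annihilates [w] iff [A w + b <= 0] component-wise ([ker_layerE]). A solution
    [u0] of [A u0 = - b] recentres this affine system: writing [w = u + u0] gives
    [A w + b = A u], so the kernel is the translate by [u0] of the solution set
    of the homogeneous system [- A u >= 0] ([ker_layer_translate]). Taking
    [M = - A] exhibits it as polyhedral, and every polyhedral set is a cone
    about its tip ([polyhedral_convex_coneP]). The point [u0] exists because the range of [A],
    being a linear subspace, contains [- b] along with [b]. *)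

(** Moving a point away from the tip multiplies its displacement from [v0] by
    [1 + alpha >= 0], and [M u >= 0] is stable under such dilations. *)
Lemma polyhedral_convex_coneP (R : realType) (n : nat) (v0 : 'cV[R]_n)
    (C : set 'cV[R]_n) :
  polyhedral v0 C -> polyhedral_convex_cone v0 C.
Proof.
move=> polyC; split=> //; case: polyC => M -> _ alpha [u Mu_ge0 <-] alpha_ge0.
exists ((1 + alpha) *: u); last by rewrite addrK scalerDl scale1r addrAC.
by move=> i; rewrite -scalemxAr mxE mulr_ge0 ?addr_ge0.
Qed.

(** The sign condition on [sigma] turns the nonlinear equation into linear
    inequalities: positivity of one component would make that component of the
    output nonzero. *)
Lemma ker_layerE (R : realType) (n : nat) (A : 'M[R]_n) (b : 'cV[R]_n)
    (sigma : R -> R)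
    (sigma_nonpos : forall x : R, x <= 0 -> sigma x = 0)
    (sigma_pos : forall x : R, 0 < x -> sigma x <> 0) :
  ker (layer sigma A b) = [set w | cv_ge0 (- (A *m w + b))].
Proof.
apply/seteqP; split=> w /=; rewrite /ker /layer /=.
- move=> Tw0 i; rewrite mxE oppr_ge0 leNgt; apply/negP => /sigma_pos; apply.
  by move/matrixP/(_ i 0): Tw0; rewrite !mxE.
- move=> le0; apply/matrixP => i j; rewrite (ord1 j) mxE [RHS]mxE.
  by apply: sigma_nonpos; have := le0 i; rewrite mxE oppr_ge0.
Qed.

Lemma ker_layer_translate (R : realType) (n : nat) (A : 'M[R]_n)
    (b u0 : 'cV[R]_n) (sigma : R -> R)
    (sigma_nonpos : forall x : R, x <= 0 -> sigma x = 0)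
    (sigma_pos : forall x : R, 0 < x -> sigma x <> 0) :
  A *m u0 = - b ->
  ker (layer sigma A b) =
    [set u + u0 | u in [set u : 'cV[R]_n | cv_ge0 (- (A *m u))]].
Proof.
move=> Au0; rewrite ker_layerE //; apply/seteqP; split=> [w | _ [u Au_le0 <-]] /=.
- move=> Aw_le0; exists (w - u0); last by rewrite subrK.
  by rewrite /= mulmxBr Au0 opprK.
- by rewrite mulmxDr Au0 subrK.
Qed.

Theorem theorem3p4 (R : realType) (n : nat) (A : 'M[R]_n) (b : 'cV[R]_n)
    (sigma : R -> R)
    (b_ran : range (fun u : 'cV[R]_n => A *m u) b)
    (sigma_nonpos : forall x : R, x <= 0 -> sigma x = 0)
    (sigma_pos : forall x : R, 0 < x -> sigma x <> 0) :
  (exists u0 : 'cV[R]_n, A *m u0 = - b) /\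
  (forall u0 : 'cV[R]_n, A *m u0 = - b ->
     polyhedral_convex_cone u0 (ker (layer sigma A b)) /\
     ker (layer sigma A b) =
       [set u + u0 | u in [set u : 'cV[R]_n | cv_ge0 (- (A *m u))]]).
Proof.
split.
  by case: b_ran => v _ <-; exists (- v); rewrite mulmxN.
move=> u0 Au0.
have kerE := ker_layer_translate R n A b u0 sigma sigma_nonpos sigma_pos Au0.
split=> //; apply: polyhedral_convex_coneP.
exists (- A); rewrite kerE; congr image.
by apply/seteqP; split=> u /=; rewrite mulNmx.
Qed.
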